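(* Let $P, Q, R$ be unary predicate symbols, let $S$ be a nullary predicate symbol (propositional letter), and consider the sentences $$\Gamma := \forall x\, \exists y\, (Py \wedge (Qy \to Rx)) \wedge \neg \forall x\, Rx,$$ $$\Delta := \bigl(\forall x\, (Px \to (Qx \vee S))\bigr) \to S,$$ $$\Theta := \forall x\, \bigl(\neg Px \vee \exists y\, (Py \wedge (Qy \to Px))\bigr) \wedge \neg \forall x\, (\neg Px \vee Qx).$$ Then: (1) the implication $\Gamma \to \Theta$ is valid in predicate Gödel logic $\mathbf{G}$, i.e. it is forced at the base point of every linear model over a language containing $P, Q, R$; (2) the implication $\Theta \to \Delta$ is valid in constant domain intuitionistic predicate logic $\mathbf{CD}$, i.e. it is forced at the base point of every model (not necessarily linear) over a language containing $P, Q, S$.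
   Context: Models. Let $\mathcal{L}$ be a finite set of predicate symbols, each unary or nullary. A model over $\mathcal{L}$ is a tuple $M = (W, \leq, w_0, A, (P^W)_{P \in \mathcal{L}})$ where $(W, \leq)$ is a quasi-order (reflexive and transitive), the base point $w_0 \in W$ satisfies $w_0 \leq w$ for all $w \in W$, $A$ is a set (the constant domain), and each unary $P \in \mathcal{L}$ is interpreted by an order-preserving function $P^W \colon W \to \mathcal{P}(A)$, i.e. $w \leq w'$ implies $P^W(w) \subseteq P^W(w')$. A nullary symbol $S$ is interpreted by an upward closed subset $S^W$ of $W$. Formulas are built from atomic formulas and $\bot$ using $\wedge, \vee, \to, \forall, \exists$; $\neg \varphi$ abbreviates $\varphi \to \bot$. Forcing. For $w \in W$, a finite set of variables $X$, an assignment $a \colon X \to A$, and a formula $\varphi$ whose free variables lie in $X$, the relation $w, a \Vdash \varphi$ is defined by induction: - $w, a \Vdash Px$ iff $a(x) \in P^W(w)$; and $w, a \Vdash S$ iff $w \in S^W$ for nullary $S$; - $w, a \Vdash \varphi \vee \psi$ iff $w, a \Vdash \varphi$ or $w, a \Vdash \psi$; - $w, a \Vdash \varphi \wedge \psi$ iff $w, a \Vdash \varphi$ and $w, a \Vdash \psi$; - $w, a \Vdash \varphi \to \psi$ iff for all $w' \geq w$, if $w', a \Vdash \varphi$ then $w', a \Vdash \psi$; - $w, a \not\Vdash \bot$; - $w, a \Vdash \exists y\, \varphi$ (with $y \notin X$) iff there is $b \in A$ with $w, a \cup \{(y,b)\} \Vdash \varphi$; - $w, a \Vdash \forall y\, \varphi$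 (with $y \notin X$) iff for all $b \in A$, $w, a \cup \{(y,b)\} \Vdash \varphi$. For a sentence $\varphi$, write $w \Vdash \varphi$ for forcing under the empty assignment. Linear models. A model over $\mathcal{L}$ is linear if for any two formulas $\varphi, \psi$ over $\mathcal{L}$, the formula $(\varphi \to \psi) \vee (\psi \to \varphi)$ is forced at the base point $w_0$ under every assignment. Validity. A sentence is valid in $\mathbf{CD}$ if it is forced at the base point of every model over a language containing its predicate symbols; it is valid in $\mathbf{G}$ if it is forced at the base point of every linear model over such a language. *)

(* Defs.v *)
From mathcomp Require Import all_boot.
From mathcomp Require Import finmap.

Set Implicit Arguments.
Unset Strict Implicit.
Unset Printing Implicit Defensive.

Local Open Scope fset_scope.
Local Open Scope fmap_scope.

Definition var := nat.
Definition usym := nat.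
Definition nsym := nat.

Record language := Language {
  unary : {fset usym};
  nullary : {fset nsym}
}.

Inductive form : Type :=
| Atom of usym & var
| Prop0 of nsym
| Bot
| And of form & form
| Or of form & form
| Imp of form & form
| All of var & form
| Ex of var & form.

Definition Neg (p : form) : form := Imp p Bot.

Declare Scope fml_scope.
Delimit Scope fml_scope with fml.
Bind Scope fml_scope with form.
Notation "p /\ q" := (And p q) : fml_scope.
Notation "p \/ q" := (Or p q) : fml_scope.
Notation "p -> q" := (Imp p q) : fml_scope.
Notation "~ p" := (Neg p) : fml_scope.

Fixpoint fv (p : form) : {fset var} :=
  match p with
  | Atom _ x => [fset x]
  | Prop0 _ | Bot => fset0
  | And p q | Or p q | Imp p q => fv p `|` fv q
  | All x p | Ex x p => fv p `\ x
  end.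

Fixpoint over (L : language) (p : form) : bool :=
  match p with
  | Atom P _ => P \in unary L
  | Prop0 T => T \in nullary L
  | Bot => true
  | And p q | Or p q | Imp p q => over L p && over L q
  | All _ p | Ex _ p => over L p
  end.

(* The domain may be empty; its elements are the same at all worlds. *)
Record model (L : language) := Model {
  world : Type;
  le : world -> world -> Prop;
  le_refl : forall w, le w w;
  le_trans : forall u v w, le u v -> le v w -> le u w;
  base : world;
  base_le : forall w, le base w;
  dom : Type;
  uint : unary L -> world -> dom -> Prop;
  uint_mono : forall P w w', le w w' ->
    forall d, uint P w d -> uint P w' d;
  nint : nullary L -> world -> Prop;
  nint_mono : forall T w w', le w w' -> nint T w -> nint T w'
}.

(* An assignment on a finite set X of variables is a finite map with domain X.
   Atoms outside the language, or whose variable is unassigned, are given the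
   value False; this case does not arise when [over L p] and
   [fv p `<=` domf a].  A quantifier on a variable already in X overrides its
   value, which amounts to renaming the bound variable away from X. *)
Fixpoint forces (L : language) (M : model L) (w : world M)
    (a : {fmap var -> dom M}) (p : form) : Prop :=
  match p with
  | Atom P x => exists (hP : P \in unary L) (d : dom M),
      a.[? x] = Some d /\ uint [` hP] w d
  | Prop0 T => exists hT : T \in nullary L, nint [` hT] w
  | Bot => False
  | And p q => forces w a p /\ forces w a q
  | Or p q => forces w a p \/ forces w a q
  | Imp p q => forall w', le w w' -> forces w' a p -> forces w' a q
  | All y p => forall b : dom M, forces w a.[y <- b] p
  | Ex y p => exists b : dom M, forces w a.[y <- b] p
  end.

Definition linear (L : language) (M : model L) : Prop :=
  forall p q : form, over L p -> over L q ->
  forall a : {fmap var -> dom M}, fv p `|` fv q `<=` domf a ->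
  forces (base M) a ((p -> q) \/ (q -> p))%fml.

Definition sentence (p : form) : Prop := fv p = fset0.

Definition valid_CD (p : form) : Prop :=
  sentence p /\
  forall (L : language) (M : model L), over L p -> forces (base M) [fmap] p.

Definition valid_G (p : form) : Prop :=
  sentence p /\
  forall (L : language) (M : model L), linear M -> over L p ->
  forces (base M) [fmap] p.

Section Sentences.
Variables (P Q R : usym) (S : nsym).
Local Notation x := 0 (only parsing).
Local Notation y := 1 (only parsing).

Definition Gamma : form :=
  (All x (Ex y (Atom P y /\ (Atom Q y -> Atom R x))) /\
   ~ All x (Atom R x))%fml.

Definition Delta : form :=
  (All x (Atom P x -> (Atom Q x \/ Prop0 S)) -> Prop0 S)%fml.

Definition Theta : form :=
  (All x (~ Atom P x \/ Ex y (Atom P y /\ (Atom Q y -> Atom P x))) /\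
   ~ All x (~ Atom P x \/ Atom Q x))%fml.

End Sentences.

(* Main.v *)
From mathcomp Require Import all_boot finmap.
From Stdlib Require Import Classical.
Require Import Defs.

Set Implicit Arguments.
Unset Strict Implicit.
Unset Printing Implicit Defensive.

Local Open Scope fset_scope.
Local Open Scope fmap_scope.

(** Both implications are proved on the meaning of the sentences
    ([forces_Gamma], [forces_Theta]), reasoning classically about the model.

    From [Gamma] to [Theta] in a linear model ([linear_Gamma_Theta]): fix an
    element [d] and compare [P d] with every [R c].  If some [R c] implies
    [P d], then the witness [e] that [Gamma] gives for [c] satisfies [P e] and
    [Q e -> R c], hence [Q e -> P d], which is the second disjunct of [Theta].
    Otherwise, by linearity ([linear_atoms]), [P d] implies every [R c]; since
    [forall x, R x] is refuted, so is [P d].  As for the negative half of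
    [Theta], the formula [forall x, ~ P x \/ Q x] turns every witness [e] of
    [Gamma] into one with [Q e], and so gives [forall x, R x].

    From [Theta] to [Delta] in an arbitrary model ([Theta_Delta]): at a world
    forcing the premise of [Delta] but not [S], [P] is contained in [Q].  The
    first conjunct of [Theta] then gives, for each [d], either [~ P d], or
    some [e] with [P e], hence [Q e], hence [P d], hence [Q d].  So
    [forall x, ~ P x \/ Q x] is forced, against the second conjunct of
    [Theta]. *)

Section Forcing.
Variables (L : language) (M : model L).
Implicit Types (w : world M) (d e : dom M) (a : {fmap var -> dom M}).
Implicit Types (P Q R : usym) (S : nsym).

Definition holds P w d : Prop := exists hP : P \in unary L, uint [` hP] w d.

Lemma holds_mono P w w' d : le w w' -> holds P w d -> holds P w' d.
Proof. by move=> le_w [hP Pd]; exists hP; apply: uint_mono Pd. Qed.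

Lemma forces_atom P w a x d :
  a.[? x] = Some d -> forces w a (Atom P x) <-> holds P w d.
Proof.
move=> ax; split; first by case=> hP [c []]; rewrite ax => -[<-] Pd; exists hP.
by case=> hP Pd; exists hP, d.
Qed.

Lemma forces_atom_last P w a x d :
  forces w a.[x <- d] (Atom P x) <-> holds P w d.
Proof. by apply: forces_atom; rewrite fnd_set eqxx. Qed.

Lemma forces_atom_prev P w a x y d e : x != y ->
  forces w a.[x <- d].[y <- e] (Atom P x) <-> holds P w d.
Proof. by move=> /negPf xy; apply: forces_atom; rewrite !fnd_set xy eqxx. Qed.

(** [Gamma] and [Theta] are instances, with [T := R] and [T := P], of the same
    pattern. *)
Definition dominated P Q T w d : Prop :=
  exists e, holds P w e /\
    forall w', le w w' -> holds Q w' e -> holds T w' d.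

Lemma forces_dominated P Q T w a d :
  forces w a.[0 <- d] (Ex 1 (And (Atom P 1) (Imp (Atom Q 1) (Atom T 0)))) <->
  dominated P Q T w d.
Proof.
split=> -[e [Pe QT]]; exists e; split.
- by move/forces_atom_last: Pe.
- move=> w' le_w /(forces_atom_last _ _ a.[0 <- d] 1) Qe.
  exact/(forces_atom_prev _ _ a d e (isT : 0 != 1))/QT.
- exact/forces_atom_last.
- move=> w' le_w /forces_atom_last Qe.
  exact/forces_atom_prev/QT.
Qed.

Definition refuted P w d : Prop := forall w', le w w' -> ~ holds P w' d.

Lemma forces_neg_atom P w a x d :
  forces w a.[x <- d] (Neg (Atom P x)) <-> refuted P w d.
Proof.
split=> nP w' le_w.
- by move/(forces_atom_last _ _ a x); apply: nP.
- by move/forces_atom_last; apply: nP.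
Qed.

Lemma forces_Gamma P Q R w a :
  forces w a (Gamma P Q R) <->
  (forall d, dominated P Q R w d) /\
  (forall w', le w w' -> ~ forall d, holds R w' d).
Proof.
split=> -[dom_R nR]; split.
- by move=> d; apply/forces_dominated/dom_R.
- by move=> w' le_w R_all; apply: (nR w' le_w) => d; apply/forces_atom_last.
- by move=> d; apply/forces_dominated.
- by move=> w' le_w R_all; apply: (nR w' le_w) => d; apply/forces_atom_last/R_all.
Qed.

Lemma forces_neg_or P Q w a :
  forces w a (All 0 (Or (Neg (Atom P 0)) (Atom Q 0))) <->
  forall d, refuted P w d \/ holds Q w d.
Proof.
split=> PQ d; case: (PQ d).
- by move/forces_neg_atom; left.
- by move/forces_atom_last; right.
- by left; apply/forces_neg_atom.
- by right; apply/forces_atom_last.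
Qed.

Lemma forces_Theta P Q w a :
  forces w a (Theta P Q) <->
  (forall d, refuted P w d \/ dominated P Q P w d) /\
  (forall w', le w w' -> ~ forall d, refuted P w' d \/ holds Q w' d).
Proof.
split=> -[dom_P nPQ]; split.
- move=> d; case: (dom_P d) => [/forces_neg_atom|/forces_dominated]; by [left|right].
- by move=> w' le_w /(forces_neg_or P Q w' a); apply: nPQ.
- move=> d; case: (dom_P d); first by left; apply/forces_neg_atom.
  by right; apply/forces_dominated.
- by move=> w' le_w /forces_neg_or; apply: nPQ.
Qed.

(** Linearity at the base point yields a comparison that is uniform in all
    worlds, since every world lies above the base point. *)
Lemma linear_atoms P R d c :
  linear M -> P \in unary L -> R \in unary L ->
  (forall w, holds R w c -> holds P w d) \/
  (forall w, holds P w d -> holds R w c).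
Proof.
move=> linM LP LR; pose a : {fmap var -> dom M} := [fmap].[0 <- d].[1 <- c].
have Pd w : forces w a (Atom P 0) <-> holds P w d by apply: forces_atom_prev.
have Rc w : forces w a (Atom R 1) <-> holds R w c by apply: forces_atom_last.
have fv_a : fv (Atom R 1) `|` fv (Atom P 0) `<=` domf a.
  by apply/fsubsetP=> z; rewrite !inE orbF.
case: (linM (Atom R 1) (Atom P 0) LR LP a fv_a) => imp; [left | right] => w.
- by move/Rc/(imp w (base_le w))/Pd.
- by move/Pd/(imp w (base_le w))/Rc.
Qed.

Lemma linear_Gamma_Theta P Q R w a :
  linear M -> P \in unary L -> R \in unary L ->
  forces w a (Gamma P Q R) -> forces w a (Theta P Q).
Proof.
move=> linM LP LR /forces_Gamma[dom_R nR]; apply/forces_Theta; split=> [d|].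
  have [[c RP]|noRP] := classic (exists c, forall w, holds R w c -> holds P w d).
    right; have [e [Pe QR]] := dom_R c.
    by exists e; split=> // w' le_w Qe; apply/RP/QR.
  left=> w' le_w Pd; apply: (nR w' le_w) => c.
  have [RP|PR] := linear_atoms d c linM LP LR; last exact: PR.
  by case: noRP; exists c.
move=> w' le_w PQ; apply: (nR w' le_w) => d.
have [e [Pe QR]] := dom_R d; apply: QR => //.
case: (PQ e) => // nPe; case: (nPe w' (le_refl w')).
exact: holds_mono Pe.
Qed.

Lemma Theta_Delta P Q S w a :
  forces w a (Theta P Q) -> forces w a (Delta P Q S).
Proof.
move=> /forces_Theta[dom_P nPQ] w' le_w PQS; apply: NNPP => nS.
have PQ d : holds P w' d -> holds Q w' d.
  move/(forces_atom_last _ _ a 0)/(PQS d w' (le_refl w')).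
  by case=> [/forces_atom_last|/nS].
apply: (nPQ w' le_w) => d; case: (dom_P d) => [nPd|[e [Pe QP]]].
  by left=> u le_u; apply/nPd/(le_trans le_w).
by right; apply/PQ/QP/PQ => //; apply: holds_mono Pe.
Qed.

End Forcing.

Lemma sentence_Gamma_Theta P Q R : sentence (Imp (Gamma P Q R) (Theta P Q)).
Proof. by apply/fsetP=> z; rewrite !inE; case: z => [|[|z]]. Qed.

Lemma sentence_Theta_Delta P Q S : sentence (Imp (Theta P Q) (Delta P Q S)).
Proof. by apply/fsetP=> z; rewrite !inE; case: z => [|[|z]]. Qed.

Theorem theorem5 (P Q R : usym) (S : nsym) :
  valid_G (Imp (Gamma P Q R) (Theta P Q)) /\
  valid_CD (Imp (Theta P Q) (Delta P Q S)).
Proof.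
split; split=> [|L M].
- exact: sentence_Gamma_Theta.
- move=> linM /andP[/= /andP[/and3P[LP _ LR] _] _] w _.
  exact: linear_Gamma_Theta.
- exact: sentence_Theta_Delta.
- by move=> _ w _; apply: Theta_Delta.
Qed.
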